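(* Let $T_1$ and $T_2$ be two combinatorially skew-Hankel tournaments in $\mathcal{T}_{H^*}(R)$. Then there exists a sequence of moves, each of which is either a $4$-cycle skew-Hankel switch $\Box_{i,j,n+1-i,n+1-j}$ or a pair consisting of a pure $3$-cycle switch $\bigtriangleup_{i,j,k}$ and its complementary switch $\bigtriangleup^c_{i,j,k}$, which brings $T_1$ to $T_2$, such that each of the moves produces a combinatorially skew-Hankel tournament in $\mathcal{T}_{H^*}(R)$.
   Context: A combinatorially skew-Hankel tournament of order $n$ is an $n\times n$ $(0,1)$-matrix $T=[t_{ij}]$ such that $t_{ii}=t_{i,n+1-i}=0$ for all $i$, and, for all $i$ and all $j\ne i,n+1-i$, $t_{ji}=1-t_{ij}$ and $t_{n+1-j,n+1-i}=1-t_{ij}$. Its score vector is the vector of its row sums; $\mathcal{T}_{H^*}(R)$ is the set of combinatorially skew-Hankel tournaments with score vector $R=(r_1,\ldots,r_n)$. View $T$ as a digraph with an edge $i\rightarrow j$ iff $t_{ij}=1$. The $3$-cycle switch $\bigtriangleup_{i,j,k}$ ($i,j,k$ distinct) applies when $i\rightarrow j\rightarrow k\rightarrow i$ is a directed cycle of $T$ and reverses the three edges of this cycle. It is pure if $\{i,j,k\}\cap\{n+1-i,n+1-j,n+1-k\}$ is empty or equal to $\{\frac{n+1}{2}\}$. Its complementary switch is $\bigtriangleup^c_{i,j,k}=\bigtriangleup_{n+1-i,n+1-j,n+1-k}$. A $4$-cycle skew-Hankel switch $\Box_{i,j,n+1-i,n+1-j}$ (with $i,j,n+1-i,n+1-j$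 distinct) applies when $i\rightarrow j\rightarrow n+1-i\rightarrow n+1-j\rightarrow i$ is a directed cycle of $T$ and reverses the four edges of this cycle. *)

(* Defs.v *)
From mathcomp Require Import all_boot all_order all_algebra.

Set Implicit Arguments.
Unset Strict Implicit.
Unset Printing Implicit Defensive.

(* A (0,1)-matrix is a boolean matrix, so that 1 - t is ~~ t;
   the vertex with label i + 1 is the ordinal i : 'I_n, and the label
   n + 1 - (i + 1) is that of [rev_ord i]. *)

Definition skew_hankel (n : nat) (T : 'M[bool]_n) : bool :=
  [forall i : 'I_n,
    [&& ~~ T i i, ~~ T i (rev_ord i) &
      [forall j : 'I_n, (j != i) && (j != rev_ord i) ==>
        (T j i == ~~ T i j) && (T (rev_ord j) (rev_ord i) == ~~ T i j)]]].

Definition score (n : nat) (T : 'M[bool]_n) : 'rV[nat]_n :=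
  (\row_(i < n) (\sum_(j < n) (T i j : nat))%N)%R.

Definition skew_hankel_class (n : nat) (R : 'rV[nat]_n) : {set 'M[bool]_n} :=
  [set T | skew_hankel T && (score T == R)].

Definition cycle_edge (n : nat) (c : seq 'I_n) (u v : 'I_n) : bool :=
  (u \in c) && (v == next c u).

Definition reverse_cycle (n : nat) (c : seq 'I_n) (T : 'M[bool]_n) :
    'M[bool]_n :=
  (\matrix_(u < n, v < n)
    if cycle_edge c u v || cycle_edge c v u then T v u else T u v)%R.

(* T' results from T by the switch on c; this requires that the entries of c be
   distinct and form, in cyclic order, a directed cycle of T. *)
Definition cycle_switch (n : nat) (c : seq 'I_n) (T T' : 'M[bool]_n) : bool :=
  ucycleb (fun u v => T u v) c && (T' == reverse_cycle c T).

(* The middle vertex (n + 1) / 2 exists only for odd n. *)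
Definition pure (n : nat) (i j k : 'I_n) : bool :=
  let S := [set i; j; k] :&: [set rev_ord i; rev_ord j; rev_ord k] in
  (S == set0) || [exists m : 'I_n, (m.+1.*2 == n.+1) && (S == [set m])].

Definition box_move (n : nat) (T T' : 'M[bool]_n) : bool :=
  [exists i : 'I_n, exists j : 'I_n,
    cycle_switch [:: i; j; rev_ord i; rev_ord j] T T'].

(* The switch and its complement are applied one after the other; the
   intermediate matrix U need not be skew-Hankel. *)
Definition triangle_pair_move (n : nat) (T T' : 'M[bool]_n) : bool :=
  [exists i : 'I_n, exists j : 'I_n, exists k : 'I_n, pure i j k &&
    [exists U : 'M[bool]_n, cycle_switch [:: i; j; k] T U &&
      cycle_switch [:: rev_ord i; rev_ord j; rev_ord k] U T']].

Definition move (n : nat) (T T' : 'M[bool]_n) : bool :=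
  box_move T T' || triangle_pair_move T T'.

(* Main.v *)
Require Import Defs.
From mathcomp Require Import all_boot all_order all_algebra.
From mathcomp Require Import zify.

Set Implicit Arguments.
Unset Strict Implicit.
Unset Printing Implicit Defensive.

(** The two complementation conditions together say that the antipodal map
    [rev_ord] is an automorphism of the digraph T: T orients a complete
    multipartite graph with parts {i, n+1-i}, invariantly under the antipodal
    map.  A box runs back and forth between two parts, and a directed triangle
    meets three different parts, so that every directed triangle is pure
    ([cycle3_pure]).

    Given T and S with the same scores, let the excess be the set of arcs of T
    that are not arcs of S.  If it is nonempty, one move applied to T or to S
    makes it smaller.  Equality of scores means that every vertex entered by an
    excess arc is also left by one, so the excess relation, being finite and
    irreflexive, is not transitive ([no_dead_end_not_transitive]): there are
    excess arcs x -> y -> z such that x -> z is not an excess arc.  Asymmetry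
    gives z <> x.
    - If z is the antipode of x, then x, y, z and the antipode of y form a box
      of T, all of whose arcs are excess; reversing it removes them.
    - Otherwise x and z are adjacent, and since x -> z is not an excess arc,
      z -> x in T or x -> z in S.  In the first case x -> y -> z -> x is a
      cycle of T, in the second z -> y -> x -> z is a cycle of S.  Reversing it
      together with its complement repairs the arcs on {x, y} and {y, z} and
      their antipodes, and damages at most those on {z, x} and its antipode.

    As moves can be undone, moving S is as good as moving T, and induction on
    the size of the excess connects T with S ([step_connect]). *)

(** * The antipodal map as an automorphism *)

Lemma rev_ord_fix_inj n (u v : 'I_n) : rev_ord u = u -> rev_ord v = v -> u = v.
Proof.
move=> /(congr1 val) /= hu /(congr1 val) /= hv; apply: val_inj => /=.
have := ltn_ord u; have := ltn_ord v; lia.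
Qed.

Lemma rev_ord_fix_middle n (u : 'I_n) : rev_ord u = u -> u.+1.*2 == n.+1.
Proof. move=> /(congr1 val) /= hu; have := ltn_ord u; lia. Qed.

Lemma skew_irr n (T : 'M[bool]_n) i : skew_hankel T -> T i i = false.
Proof. by move/forallP/(_ i)/and3P => [/negbTE]. Qed.

Lemma skew_antipode n (T : 'M[bool]_n) i :
  skew_hankel T -> T i (rev_ord i) = false.
Proof. by move/forallP/(_ i)/and3P => [_ /negbTE]. Qed.

Lemma skew_total n (T : 'M[bool]_n) i j : skew_hankel T ->
  j != i -> j != rev_ord i -> T j i = ~~ T i j.
Proof.
move=> /forallP/(_ i)/and3P[_ _ /forallP/(_ j)/implyP H] h1 h2.
by move: H; rewrite h1 h2 => /(_ isT)/andP[/eqP].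
Qed.

Lemma skew_rev n (T : 'M[bool]_n) i j : skew_hankel T ->
  T (rev_ord i) (rev_ord j) = T i j.
Proof.
move=> hT; have [->|nij] := eqVneq j i; first by rewrite !skew_irr.
have [->|nij'] := eqVneq j (rev_ord i); first by rewrite !skew_antipode.
have nji' : i != rev_ord j.
  by apply: contraNneq nij' => ->; rewrite rev_ordK.
move: (hT) => /forallP/(_ j)/and3P[_ _ /forallP/(_ i)/implyP].
by rewrite eq_sym nij nji' => /(_ isT)/andP[/eqP -> /eqP].
Qed.

Lemma skew_hankel_intro n (T : 'M[bool]_n) :
  (forall i, T i i = false) -> (forall i, T i (rev_ord i) = false) ->
  (forall i j, j != i -> j != rev_ord i -> T j i = ~~ T i j) ->
  (forall i j, T (rev_ord i) (rev_ord j) = T i j) -> skew_hankel T.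
Proof.
move=> h1 h2 h3 h4; apply/forallP => i; rewrite h1 h2 /=.
by apply/forallP => j; apply/implyP => /andP[a b]; rewrite h4 h3 ?eqxx.
Qed.

Lemma skew_arc n (T : 'M[bool]_n) i j : skew_hankel T -> T i j ->
  j != i /\ j != rev_ord i.
Proof.
by move=> hT hij; split; apply: contraTneq hij => ->;
  rewrite ?skew_irr ?skew_antipode.
Qed.

Lemma skew_asym n (T : 'M[bool]_n) i j : skew_hankel T -> T i j -> T j i = false.
Proof.
move=> hT hij; have [a b] := skew_arc hT hij.
by rewrite (@skew_total _ T i) // hij.
Qed.

(** * Reversing a symmetric set of edges *)

(** Reversing a cycle is flipping the set of its edges; a move composed of two
    switches is then a single flip, which is visibly an involution. *)
Definition flip n (s : rel 'I_n) (T : 'M[bool]_n) : 'M[bool]_n :=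
  (\matrix_(u < n, v < n) if s u v then T v u else T u v)%R.

Definition uedge n (c : seq 'I_n) : rel 'I_n :=
  fun u v => cycle_edge c u v || cycle_edge c v u.

Lemma uedge_sym n (c : seq 'I_n) : symmetric (uedge c).
Proof. by move=> u v; rewrite /uedge orbC. Qed.

Lemma flip_skew n (s : rel 'I_n) (T : 'M[bool]_n) :
  symmetric s -> (forall u v, s (rev_ord u) (rev_ord v) = s u v) ->
  skew_hankel T -> skew_hankel (flip s T).
Proof.
move=> ssym srev hT; apply: skew_hankel_intro => [i|i|i j h1 h2|i j]; rewrite !mxE.
- by rewrite skew_irr // if_same.
- have h : T (rev_ord i) i = false by rewrite -{2}(rev_ordK i) skew_antipode.
  by rewrite h skew_antipode // if_same.
- by rewrite ssym; case: ifP => _; rewrite (@skew_total _ T i j) // negbK.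
- by rewrite srev !skew_rev.
Qed.

Lemma flipK n (s : rel 'I_n) : symmetric s -> involutive (@flip n s).
Proof.
by move=> ssym T; apply/matrixP => u v; rewrite !mxE (ssym v u); case: (s u v).
Qed.

Lemma eq_flip n (s s' : rel 'I_n) (T : 'M[bool]_n) :
  s =2 s' -> flip s T = flip s' T.
Proof. by move=> ss; apply/matrixP => u v; rewrite !mxE ss. Qed.

Lemma flip_disjoint n (s1 s2 : rel 'I_n) (T : 'M[bool]_n) :
  symmetric s2 -> (forall u v, s1 u v -> s2 u v = false) ->
  flip s2 (flip s1 T) = flip (fun u v => s1 u v || s2 u v) T.
Proof.
move=> sym dis; apply/matrixP => u v; rewrite !mxE.
case h2: (s2 u v); last by rewrite orbF.
by rewrite orbT; case: ifP => // /dis; rewrite sym h2.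
Qed.

(** * Moves preserve scores *)

Lemma cycle_edge_arc n (T : 'M[bool]_n) c u v :
  ucycleb (fun u v => T u v) c -> cycle_edge c u v -> T u v.
Proof.
by move=> /andP[hc _] /andP[uc /eqP ->]; exact: next_cycle hc uc.
Qed.

(** Each vertex of the cycle gains one out-arc and loses one: the sum over the
    row of u of the new entry plus [cycle_edge c u v] equals the sum of the old
    entry plus [cycle_edge c v u], and both cycle terms add up to 1 or to 0
    according to whether u is on the cycle. *)
Lemma score_reverse_cycle n (T : 'M[bool]_n) c :
  (forall u v, T u v -> T v u = false) -> ucycleb (fun u v => T u v) c ->
  score (reverse_cycle c T) = score T.
Proof.
move=> asym hc; have [_ uc] := andP hc.
apply/rowP => u; rewrite !mxE.
have out : \sum_(v < n) (cycle_edge c u v : nat) = (u \in c).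
  rewrite (bigD1 (next c u)) //= /cycle_edge eqxx andbT big1 ?addn0 // => v.
  by move/negbTE => ->; rewrite andbF.
have inn : \sum_(v < n) (cycle_edge c v u : nat) = (u \in c).
  rewrite (bigD1 (prev c u)) //= /cycle_edge next_prev // eqxx andbT.
  rewrite mem_prev big1 ?addn0 // => v /negP hv; apply/eqP; rewrite eqb0.
  by apply/negP => /andP[_ /eqP hu]; apply: hv; rewrite hu prev_next.
apply/eqP; rewrite -(eqn_add2r (u \in c)) -{1}out -inn -!big_split /=.
apply/eqP/eq_bigr => v _; rewrite !mxE.
case h1: (cycle_edge c u v).
  have a := cycle_edge_arc hc h1; rewrite /= a (asym _ _ a).
  case h2: (cycle_edge c v u) => //.
  by move: (cycle_edge_arc hc h2); rewrite (asym _ _ a).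
case h2: (cycle_edge c v u) => //.
by have a := cycle_edge_arc hc h2; rewrite /= a (asym _ _ a).
Qed.

(** The matrix between the two switches of a triangle move is asymmetric
    but need not be skew-Hankel, which is why scores are followed through
    asymmetry alone. *)
Lemma flip_asym n (T : 'M[bool]_n) (s : rel 'I_n) : symmetric s ->
  (forall u v, T u v -> T v u = false) ->
  forall u v, flip s T u v -> flip s T v u = false.
Proof. by move=> sym asym u v; rewrite !mxE sym; case: ifP => _ /asym. Qed.

Lemma move_score n (T T' : 'M[bool]_n) :
  skew_hankel T -> move T T' -> score T' = score T.
Proof.
move=> hT; have asym u v := @skew_asym n T u v hT.
case/orP => [/existsP[i /existsP[j /andP[hc /eqP ->]]]|]; first exact: score_reverse_cycle.
move=> /existsP[i /existsP[j /existsP[k /andP[_]]]].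
case/existsP=> U /andP[/andP[hc /eqP eU]]; case/andP=> hc' /eqP ->.
rewrite (@score_reverse_cycle _ U) ?eU ?score_reverse_cycle -?eU // eU.
exact: flip_asym (@uedge_sym _ _) asym.
Qed.

(** * Antipodal pairs of cycles *)

Lemma cycle_edge_rev n (c : seq 'I_n) u v : uniq c ->
  cycle_edge (map (@rev_ord n) c) (rev_ord u) (rev_ord v) = cycle_edge c u v.
Proof.
move=> uc; rewrite /cycle_edge mem_map; last exact: rev_ord_inj.
by rewrite (next_map rev_ord_inj) // (inj_eq rev_ord_inj).
Qed.

Lemma cycle_edge_revl n (c : seq 'I_n) u v : uniq c ->
  cycle_edge (map (@rev_ord n) c) u v = cycle_edge c (rev_ord u) (rev_ord v).
Proof. by move=> uc; rewrite -{1}(rev_ordK u) -{1}(rev_ordK v) cycle_edge_rev. Qed.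

Definition paired_edge n (c : seq 'I_n) : rel 'I_n :=
  fun u v => uedge c u v || uedge (map (@rev_ord n) c) u v.

Lemma paired_edge_sym n (c : seq 'I_n) : symmetric (paired_edge c).
Proof. by move=> u v; rewrite /paired_edge uedge_sym (uedge_sym (map _ _)). Qed.

Lemma paired_edge_rev n (c : seq 'I_n) u v : uniq c ->
  paired_edge c (rev_ord u) (rev_ord v) = paired_edge c u v.
Proof.
move=> uc; rewrite /paired_edge /uedge !cycle_edge_rev //.
by rewrite orbC !cycle_edge_revl.
Qed.

Lemma paired_edgeP n (c : seq 'I_n) u v : uniq c -> paired_edge c u v ->
  uedge c u v \/ uedge c (rev_ord u) (rev_ord v).
Proof.
by move=> uc /orP[|]; [left|right; rewrite /uedge -!cycle_edge_revl].
Qed.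

Lemma cycle_edge3 n (i j k u v : 'I_n) : uniq [:: i; j; k] ->
  cycle_edge [:: i; j; k] u v =
  [|| (u == i) && (v == j), (u == j) && (v == k) | (u == k) && (v == i)].
Proof.
rewrite /= !inE !andbT negb_or => /andP[/andP[ij ik] jk].
rewrite /cycle_edge !inE /= (eq_sym u i) (eq_sym u j) (eq_sym u k).
have [<-|_] := eqVneq i u.
  by rewrite (eq_sym j) (eq_sym k) (negbTE ij) (negbTE ik) /= !orbF.
have [<-|_] := eqVneq j u.
  by rewrite (eq_sym k) (negbTE jk) /= !orbF.
by case: eqP.
Qed.

Lemma cycle_edge3_rev n (i j k u v : 'I_n) : uniq [:: i; j; k] ->
  cycle_edge [:: i; k; j] u v = cycle_edge [:: i; j; k] v u.
Proof.
move=> uc; rewrite !cycle_edge3 //; last first.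
  by rewrite -[X in uniq X]/(rot 2 (rev [:: i; j; k])) rot_uniq rev_uniq.
by do 6! case: (_ == _).
Qed.

Lemma cycle_edge4 n (i j k l u v : 'I_n) : uniq [:: i; j; k; l] ->
  cycle_edge [:: i; j; k; l] u v =
  [|| (u == i) && (v == j), (u == j) && (v == k), (u == k) && (v == l)
    | (u == l) && (v == i)].
Proof.
rewrite /= !inE !andbT !negb_or => /and3P[/and3P[ij ik il] /andP[jk jl] kl].
rewrite /cycle_edge !inE /= !(eq_sym u).
have [<-|_] := eqVneq i u.
  by rewrite !(eq_sym _ i) (negbTE ij) (negbTE ik) (negbTE il) /= !orbF.
have [<-|_] := eqVneq j u.
  by rewrite !(eq_sym _ j) (negbTE jk) (negbTE jl) /= !orbF.
have [<-|_] := eqVneq k u.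
  by rewrite !(eq_sym _ k) (negbTE kl) /= !orbF.
by case: eqP.
Qed.

Lemma cycle3_uniq n (T : 'M[bool]_n) i j k : skew_hankel T ->
  T i j -> T j k -> T k i -> uniq [:: i; j; k].
Proof.
move=> hT hij hjk hki; rewrite /= !inE negb_or !andbT.
have [ji _] := skew_arc hT hij; have [kj _] := skew_arc hT hjk.
by have [ik _] := skew_arc hT hki; rewrite ik (eq_sym i) ji (eq_sym j) kj.
Qed.

(** The three vertices are pairwise adjacent, hence never antipodal. *)
Lemma cycle3_antipode n (T : 'M[bool]_n) i j k u : skew_hankel T ->
  T i j -> T j k -> T k i ->
  u \in [:: i; j; k] -> rev_ord u \in [:: i; j; k] -> rev_ord u = u.
Proof.
move=> hT hij hjk hki.
have [_ ji] := skew_arc hT hij; have [_ kj] := skew_arc hT hjk.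
have [_ ik] := skew_arc hT hki.
have rv (a b : 'I_n) : a != rev_ord b -> b != rev_ord a.
  by apply: contraNneq => ->; rewrite rev_ordK.
rewrite !inE => /or3P[] /eqP -> /or3P[] /eqP // h; exfalso; move: ji kj ik;
  by rewrite ?h ?eqxx // -?h ?rev_ordK ?eqxx.
Qed.

(** A common edge of the triangle and its complement would join two vertices
    that are their own antipodes, but only the middle vertex is. *)
Lemma cycle3_disjoint n (T : 'M[bool]_n) i j k u v : skew_hankel T ->
  T i j -> T j k -> T k i ->
  uedge [:: i; j; k] u v -> uedge (map (@rev_ord n) [:: i; j; k]) u v = false.
Proof.
move=> hT hij hjk hki; set c := [:: i; j; k].
have uc : uniq c by exact: cycle3_uniq hT hij hjk hki.
have hc : ucycleb (fun u v => T u v) c by rewrite /ucycleb uc /= hij hjk hki.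
have in_c a b : cycle_edge c a b -> a \in c /\ b \in c.
  by case/andP => ac /eqP ->; rewrite mem_next.
have fixc := cycle3_antipode hT hij hjk hki.
wlog h : u v / cycle_edge c u v.
  move=> W /orP[] h; first by rewrite W // /uedge h.
  by rewrite uedge_sym W // /uedge h.
move=> _; apply/negbTE/negP; rewrite /uedge !cycle_edge_revl // => h'.
have [uc' vc'] : rev_ord u \in c /\ rev_ord v \in c.
  by case/orP: h' => /in_c [].
have [uin vin] := in_c _ _ h.
have e := rev_ord_fix_inj (fixc _ uin uc') (fixc _ vin vc').
by move: (cycle_edge_arc hc h); rewrite e skew_irr.
Qed.

Lemma cycle3_pure n (T : 'M[bool]_n) i j k : skew_hankel T ->
  T i j -> T j k -> T k i -> pure i j k.
Proof.
move=> hT hij hjk hki; rewrite /pure; set S := _ :&: _.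
have fixS u : u \in S -> rev_ord u = u.
  rewrite !inE => /andP[h1 h2].
  apply: (cycle3_antipode hT hij hjk hki); rewrite !inE ?orbA //.
  by case/orP: h2 => [/orP[]|] /eqP ->; rewrite rev_ordK eqxx ?orbT.
have [//|/set0Pn[m mS]] := boolP (S == set0).
apply/existsP; exists m; rewrite rev_ord_fix_middle /=; last exact: fixS.
apply/eqP/setP => w; rewrite inE; apply/idP/eqP => [wS|-> //].
exact: rev_ord_fix_inj (fixS _ wS) (fixS _ mS).
Qed.

Lemma triangle_move n (T : 'M[bool]_n) i j k : skew_hankel T ->
  T i j -> T j k -> T k i -> move T (flip (paired_edge [:: i; j; k]) T).
Proof.
move=> hT hij hjk hki; apply/orP; right.
apply/existsP; exists i; apply/existsP; exists j; apply/existsP; exists k.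
rewrite (cycle3_pure hT hij hjk hki) /=.
set c := [:: i; j; k]; have uc : uniq c by exact: cycle3_uniq hT hij hjk hki.
have dis u v := @cycle3_disjoint n T i j k u v hT hij hjk hki.
apply/existsP; exists (flip (uedge c) T).
have <- : reverse_cycle (map (@rev_ord n) c) (flip (uedge c) T) = flip (paired_edge c) T.
  exact: flip_disjoint (@uedge_sym _ _) dis.
rewrite /cycle_switch !eqxx !andbT.
have uc' : uniq [:: rev_ord i; rev_ord j; rev_ord k].
  by rewrite -[X in uniq X]/(map (@rev_ord n) c) map_inj_uniq //; apply: rev_ord_inj.
rewrite /ucycleb uc uc' /= hij hjk hki /=.
have U u v : cycle_edge c u v -> flip (uedge c) T (rev_ord u) (rev_ord v) = T u v.
  move=> h; rewrite mxE ifF ?skew_rev //.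
  apply/negP => /dis; rewrite /uedge !cycle_edge_revl // !rev_ordK.
  by rewrite h.
by rewrite !U ?hij ?hjk ?hki // cycle_edge3 // !eqxx ?orbT.
Qed.

(** * Reversible moves inside a class *)

(** Requiring the move in both directions makes the reachability relation
    symmetric by definition, so that paths may be extended at either end. *)
Definition step n (R : 'rV[nat]_n) : rel 'M[bool]_n := fun T T' =>
  [&& T \in skew_hankel_class R, T' \in skew_hankel_class R,
      move T T' & move T' T].

Lemma step_sym n (R : 'rV[nat]_n) : symmetric (step R).
Proof. by move=> T T'; rewrite /step andbCA (andbC (move T T')). Qed.

(** The inverse move runs through i, k, j, that is, through the same triangle
    backwards. *)
Lemma triangle_step n (R : 'rV[nat]_n) (T : 'M[bool]_n) i j k :
  T \in skew_hankel_class R ->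
  T i j -> T j k -> T k i -> step R T (flip (paired_edge [:: i; j; k]) T).
Proof.
rewrite inE => /andP[hT /eqP hR] hij hjk hki.
set c := [:: i; j; k]; have uc : uniq c by exact: cycle3_uniq hT hij hjk hki.
have ucr : uniq [:: i; k; j].
  by rewrite -[X in uniq X]/(rot 2 (rev c)) rot_uniq rev_uniq.
have m1 := triangle_move hT hij hjk hki.
have hT' : skew_hankel (flip (paired_edge c) T).
  by apply: flip_skew => // [|u v]; [exact: paired_edge_sym | exact: paired_edge_rev].
rewrite /step !inE hT hT' (move_score hT m1) hR eqxx m1 /=.
have F u v : cycle_edge c v u -> flip (paired_edge c) T u v = T v u.
  by move=> h; rewrite mxE ifT // /paired_edge /uedge h !orbT.
have := @triangle_move n _ i k j hT'.
rewrite !F ?cycle_edge3 ?eqxx ?orbT //= => /(_ hki hjk hij).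
congr (move _ _); rewrite -[RHS](flipK (@paired_edge_sym n c)).
apply: eq_flip => u v; rewrite /paired_edge /uedge !cycle_edge_revl //.
by rewrite !(cycle_edge3_rev _ _ uc); congr (_ || _); rewrite orbC.
Qed.

(** The arcs i -> j -> rev i are two of the four arcs of the box; the other two
    are their images under the antipodal automorphism. *)
Lemma box_ucycle n (T : 'M[bool]_n) i j :
  skew_hankel T -> T i j -> T j (rev_ord i) ->
  ucycleb (fun u v => T u v) [:: i; j; rev_ord i; rev_ord j].
Proof.
move=> hT hij hji'.
have [nij nij'] := skew_arc hT hij.
have nii' : i != rev_ord i.
  by apply: contraTneq hji' => <-; rewrite (skew_asym hT hij).
have njj' : j != rev_ord j.
  apply: contraTneq hij => e; rewrite e -(rev_ordK i) skew_rev //.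
  by rewrite (skew_asym hT hji').
have nji' : i != rev_ord j by apply: contraNneq nij' => ->; rewrite rev_ordK.
set c := [:: i; j; rev_ord i; rev_ord j].
have uc : uniq c.
  rewrite /= !inE !negb_or (inj_eq rev_ord_inj) (eq_sym i j).
  by rewrite nij nii' nji' nij' njj'.
rewrite /ucycleb uc /= hij hji' skew_rev // hij /= andbT.
by rewrite andbT -(rev_ordK i) skew_rev.
Qed.

(** The box reversed is the box of i and the antipode of j. *)
Lemma box_step n (R : 'rV[nat]_n) (T : 'M[bool]_n) i j :
  T \in skew_hankel_class R -> T i j -> T j (rev_ord i) ->
  step R T (reverse_cycle [:: i; j; rev_ord i; rev_ord j] T).
Proof.
rewrite inE => /andP[hT /eqP hR] hij hji'.
set c := [:: i; j; rev_ord i; rev_ord j].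
have hc := box_ucycle hT hij hji' : ucycleb (fun u v => T u v) c.
have [cT uc] := andP hc.
have ucr : uniq [:: i; rev_ord j; rev_ord i; j].
  by rewrite -[X in uniq X]/(rot 3 (rev c)) rot_uniq rev_uniq.
have nrev (a b : 'I_n) : (rev_ord a == b) = (a == rev_ord b).
  by rewrite -(inj_eq rev_ord_inj) rev_ordK.
have hT' : skew_hankel (flip (uedge c) T).
  apply: flip_skew => // [|u v]; first exact: uedge_sym.
  rewrite /uedge !cycle_edge4 // !nrev !rev_ordK.
  by do 8! case: (_ == _).
have F u v : cycle_edge c v u -> flip (uedge c) T u v = T v u.
  by move=> h; rewrite mxE ifT // /uedge h !orbT.
have m1 : move T (reverse_cycle c T).
  apply/orP; left; apply/existsP; exists i; apply/existsP; exists j.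
  by rewrite /cycle_switch hc eqxx.
rewrite /step !inE hT hT' (move_score hT m1) hR eqxx m1 /=.
apply/orP; left; apply/existsP; exists i; apply/existsP; exists (rev_ord j).
rewrite rev_ordK /cycle_switch /ucycleb ucr /=.
have /and5P[e1 e2 e3 e4 _] := cT.
rewrite /reverse_cycle -/(flip (uedge c) T).
rewrite !F ?cycle_edge4 ?eqxx ?orbT //= e1 e2 e3 e4 /=; apply/eqP.
rewrite -{1}(flipK (@uedge_sym n c) T); apply: eq_flip => u v.
rewrite /uedge !cycle_edge4 //.
by do 8! case: (_ == _).
Qed.

(** * Decreasing the excess of one tournament over another *)

Definition excess n (T S : 'M[bool]_n) : {set 'I_n * 'I_n} :=
  [set p | T p.1 p.2 && ~~ S p.1 p.2].

Lemma excess_asym n (T S : 'M[bool]_n) u v :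
  skew_hankel T -> skew_hankel S ->
  T u v -> ~~ S u v -> S v u /\ T v u = false.
Proof.
move=> hT hS h1 h2; have [a b] := skew_arc hT h1.
by rewrite (skew_asym hT h1) (@skew_total _ S u v).
Qed.

(** Transposing the arcs exchanges the two excesses; thus a move of S counts
    as much as a move of T. *)
Lemma card_excess n (T S : 'M[bool]_n) :
  skew_hankel T -> skew_hankel S -> #|excess T S| = #|excess S T|.
Proof.
move=> hT hS; pose sw (p : 'I_n * 'I_n) := (p.2, p.1).
have swK : involutive sw by case.
rewrite -(card_imset _ (inv_inj swK)); apply: eq_card => -[a b].
apply/imsetP/idP => [[[u v]]|].
  by rewrite !inE /= => /andP[h1 h2] [-> ->]; have [-> ->] := excess_asym hT hS h1 h2.
rewrite inE /= => /andP[h1 h2]; exists (b, a) => //.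
by rewrite inE /=; have [-> ->] := excess_asym hS hT h1 h2.
Qed.

Lemma excess0 n (T S : 'M[bool]_n) :
  skew_hankel T -> skew_hankel S -> excess T S = set0 -> T = S.
Proof.
move=> hT hS e; apply/matrixP => u v.
case hTu: (T u v); case hSu: (S u v) => //.
  by move/setP/(_ (u, v)): e; rewrite !inE /= hTu hSu.
have [h1 h2] := excess_asym hS hT hSu (negbT hTu).
by move/setP/(_ (v, u)): e; rewrite !inE /= h1 h2.
Qed.

(** If x has the fewest successors among the vertices that have any, a
    successor y of x has at least as many as x.  They cannot all be successors
    of x, because y is a successor of x but not of itself. *)
Lemma no_dead_end_not_transitive (V : finType) (e : rel V) x0 y0 :
  irreflexive e -> (forall x y, e x y -> exists z, e y z) -> e x0 y0 ->
  exists x y z, [/\ e x y, e y z & ~~ e x z].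
Proof.
move=> irr out e0; pose P x := [exists y, e x y].
have Px0 : P x0 by apply/existsP; exists y0.
have [x /existsP[y exy] xmin] := arg_minnP (fun x => #|[set y | e x y]|) Px0.
have Py : P y by apply/existsP; exact: out exy.
have /subsetPn[z] : ~~ ([set z | e y z] \subset [set z | e x z]).
  apply/negP => sub; have := xmin y Py; rewrite leqNgt => /negP[].
  apply/proper_card/properP; split=> //.
  by exists y; rewrite inE ?exy // irr.
by rewrite !inE => eyz nexz; exists x, y, z.
Qed.

(** At v the arc from u is missing from the row of T and present in the row of
    S, so the row sums can only agree if T has an arc from v missing in S. *)
Lemma excess_no_dead_end n (T S : 'M[bool]_n) u v :
  skew_hankel T -> skew_hankel S -> score T = score S ->
  T u v && ~~ S u v -> exists w, T v w && ~~ S v w.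
Proof.
move=> hT hS hsc /andP[h1 h2]; have [Svu Tvu] := excess_asym hT hS h1 h2.
apply/existsP; apply: contraT; rewrite negb_exists => /forallP none.
have := congr1 (fun X : 'rV_n => X ord0 v) hsc; rewrite !mxE => /eqP.
rewrite (bigD1 u) //= [X in _ == X](bigD1 u) //= Svu Tvu => /eqP sums.
have : \sum_(w < n | w != u) (T v w : nat) <= \sum_(w < n | w != u) (S v w : nat).
  by apply: leq_sum => w _; move: (none w); case: (T v w); case: (S v w).
by rewrite add0n in sums; rewrite sums ltnn.
Qed.

(** The move removes at least three excess arcs and creates at most two. *)
Lemma triangle_decreases_excess n (R : 'rV[nat]_n) (T S : 'M[bool]_n) i j k :
  T \in skew_hankel_class R -> skew_hankel S ->
  T i j -> T j k -> T k i -> ~~ S i j -> ~~ S j k ->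
  exists2 T', step R T T' & #|excess T' S| < #|excess T S|.
Proof.
move=> hTR hS hij hjk hki nij njk.
have hT : skew_hankel T by move: hTR; rewrite inE => /andP[].
have := triangle_step hTR hij hjk hki.
set c := [:: i; j; k]; set T' := flip _ _.
move=> hst; exists T' => //.
have uc : uniq c by exact: cycle3_uniq hT hij hjk hki.
have hc : ucycleb (fun u v => T u v) c by rewrite /ucycleb uc /= hij hjk hki.
have hT' : skew_hankel T' by case/and4P: hst => _; rewrite inE => /andP[].
have gone u v : cycle_edge c u v -> T' u v = false.
  by move=> h; rewrite mxE ifT ?(skew_asym hT (cycle_edge_arc hc h)) // /paired_edge /uedge h.
have Tij : T' i j = false by rewrite gone // cycle_edge3 // !eqxx.
have Tjk : T' j k = false by rewrite gone // cycle_edge3 // !eqxx !orbT.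
have new u v : ~~ S u v -> cycle_edge c v u -> (u, v) = (i, k).
  rewrite cycle_edge3 // => nS /or3P[] /andP[/eqP ev /eqP eu] //; last by rewrite ev eu.
    by move: nS; rewrite eu ev; have [->] := excess_asym hT hS hij nij.
  by move: nS; rewrite eu ev; have [->] := excess_asym hT hS hjk njk.
pose E := excess T S; pose E' := excess T' S.
(* Three removed arcs already outnumber the two that may appear. *)
pose D := [set (i, j); (j, k); (rev_ord i, rev_ord j)].
pose A := [set (i, k); (rev_ord i, rev_ord k)].
have DE : D \subset E.
  by apply/subsetP => p; rewrite !inE => /orP[/orP[]|] /eqP -> /=;
    rewrite ?skew_rev ?hij ?hjk.
have cardD : #|D| = 3.
  rewrite /D -setUA !cardsU1 cards1 !inE !xpair_eqE.
  move: uc; rewrite /= !inE negb_or !andbT => /andP[/andP[nIJ nIK] nJK].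
  rewrite (negbTE nIJ) /=.
  (* An arc fixed by the antipodal map would have two middle vertices as ends. *)
  have -> : (i == rev_ord i) && (j == rev_ord j) = false.
    apply/negP => /andP[/eqP ei /eqP ej]; move/eqP: nIJ; apply.
    exact: rev_ord_fix_inj (esym ei) (esym ej).
  have -> // : (j == rev_ord i) = false.
  by apply/negbTE; have [] := skew_arc hT hij.
have sub : E' \subset (E :\: D) :|: A.
  apply/subsetP => -[u v]; rewrite [_ \in E']inE /= => /andP[tuv nuv].
  apply/setUP; have [tE|tE] := boolP (T u v).
    left; rewrite inE [_ \in E]inE /= tE nuv !andbT; apply/negP.
    by case/setUP => [/setUP[]|] /set1P [eu ev]; move: tuv;
      rewrite eu ev ?skew_rev ?Tij ?Tjk.
  right; apply/set2P.
  have /(paired_edgeP uc) [] : paired_edge c u v.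
    by move: tuv; rewrite mxE; case: ifP => // _; rewrite (negbTE tE).
    case/orP => h; first by rewrite (cycle_edge_arc hc h) in tE.
    by left; exact: new nuv h.
  case/orP => h.
    by move: (cycle_edge_arc hc h); rewrite skew_rev // (negbTE tE).
  have := new (rev_ord u) (rev_ord v); rewrite skew_rev // => /(_ nuv h) [eu ev].
  by right; rewrite -eu -ev !rev_ordK.
apply: leq_ltn_trans (subset_leq_card sub) _.
apply: leq_ltn_trans (leq_card_setU _ _) _.
have cA : #|A| <= 2 by rewrite cards2; case: (_ != _).
have := subset_leq_card DE; rewrite cardsD (setIidPr DE) cardD -/E => le3.
apply: leq_ltn_trans (leq_add (leqnn _) cA) _.
by rewrite -[X in _ < X](subnK le3) ltn_add2l.
Qed.

Lemma box_decreases_excess n (R : 'rV[nat]_n) (T S : 'M[bool]_n) i j :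
  T \in skew_hankel_class R -> skew_hankel S ->
  T i j -> T j (rev_ord i) -> ~~ S i j -> ~~ S j (rev_ord i) ->
  exists2 T', step R T T' & #|excess T' S| < #|excess T S|.
Proof.
move=> hTR hS hij hji' nij nji'.
have hT : skew_hankel T by move: hTR; rewrite inE => /andP[].
eexists; first exact: box_step hTR hij hji'.
have hc := box_ucycle hT hij hji'; have [_ uc] := andP hc.
set c := [:: i; j; rev_ord i; rev_ord j] in hc uc *.
have Sc u v : cycle_edge c u v -> ~~ S u v.
  rewrite cycle_edge4 // => /or4P[] /andP[/eqP -> /eqP ->] //.
    by rewrite skew_rev.
  by rewrite -(rev_ordK i) skew_rev.
have cij : cycle_edge c i j by rewrite cycle_edge4 // !eqxx.
apply/proper_card/properP; split.
  apply/subsetP => -[u v]; rewrite !inE /= => /andP[h nuv].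
  rewrite nuv andbT; apply: contraLR h => nT; rewrite mxE.
  case: ifP => [/orP[] h|_ //]; first by rewrite (cycle_edge_arc hc h) in nT.
  have [Suv _] := excess_asym hT hS (cycle_edge_arc hc h) (Sc _ _ h).
  by rewrite Suv in nuv.
exists (i, j); first by rewrite inE /= hij.
by rewrite inE /= mxE cij /= (skew_asym hT hij).
Qed.

Lemma step_connect n (R : 'rV[nat]_n) (T S : 'M[bool]_n) :
  T \in skew_hankel_class R -> S \in skew_hankel_class R ->
  connect (step R) T S.
Proof.
have [k] := ubnP #|excess T S|; elim: k T S => // k IH T S; rewrite ltnS => hk hTR hSR.
move: (hTR) (hSR); rewrite !inE => /andP[hT /eqP hsT] /andP[hS /eqP hsS].
have [e0|[[x0 y0]]] := set_0Vmem (excess T S).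
  by rewrite (excess0 hT hS e0) connect0.
rewrite inE /= => exy0.
have goT : (exists2 T', step R T T' & #|excess T' S| < #|excess T S|) ->
    connect (step R) T S.
  case=> T' st lt; apply: connect_trans (connect1 st) _.
  by apply: IH => //; [exact: leq_trans lt hk | case/and4P: st].
have goS : (exists2 S', step R S S' & #|excess S' T| < #|excess S T|) ->
    connect (step R) T S.
  case=> S' st lt; have hS' : S' \in skew_hankel_class R by case/and4P: st.
  have hS'' : skew_hankel S' by move: hS'; rewrite inE => /andP[].
  apply: (@connect_trans _ _ S').
    2: by rewrite (sym_connect_sym (@step_sym n R)) connect1.
  apply: IH => //; rewrite card_excess //; apply: leq_trans lt _.
  by rewrite -card_excess.
pose e : rel 'I_n := fun u v => T u v && ~~ S u v.
have [||x [y [z [exy eyz nexz]]]] := @no_dead_end_not_transitive _ e x0 y0 _ _ exy0.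
- by move=> u; rewrite /e skew_irr.
- move=> u v; apply: excess_no_dead_end => //; by rewrite hsT hsS.
case/andP: (exy) => Txy Sxy; case/andP: (eyz) => Tyz Syz.
have [Syx Tyx] := excess_asym hT hS Txy Sxy.
have [Szy Tzy] := excess_asym hT hS Tyz Syz.
have [ezx|nzx] := eqVneq z (rev_ord x).
  by apply: goT; apply: (@box_decreases_excess _ _ _ _ x y); rewrite // -ezx.
have [ezx|nzx'] := eqVneq z x.
  by rewrite -ezx Tzy in Txy.
move: nexz; rewrite negb_and negbK; case/orP => h.
  apply: goT; apply: (@triangle_decreases_excess _ _ _ _ x y z) => //.
  by rewrite (@skew_total _ T x).
apply: goS; apply: (@triangle_decreases_excess _ _ _ _ z y x);
  by rewrite ?Tzy ?Tyx.
Qed.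

Theorem theorem28 (n : nat) (R : 'rV[nat]_n) (T1 T2 : 'M[bool]_n)
    (hT1 : T1 \in skew_hankel_class R) (hT2 : T2 \in skew_hankel_class R) :
  exists s : seq 'M[bool]_n,
    [/\ path (@move n) T1 s, last T1 s = T2 &
        forall T, T \in s -> T \in skew_hankel_class R].
Proof.
have /connectP[s ps ->] := step_connect hT1 hT2; exists s; split=> //.
  by apply: sub_path ps => T T' /and4P[].
elim: s T1 {hT1 hT2} ps => //= T s IH T1 /andP[/and4P[_ hT _ _] ps] U.
by rewrite inE => /predU1P[-> //|]; exact: IH ps U.
Qed.
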